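(* Let $\mathbb{O}$ be an octonion algebra over a field $k$ of characteristic not two or three, and let $\rho:\mathfrak{g}\to\mathfrak{so}(\mathrm{Im}(\mathbb{O}),B)$ be the $7$-dimensional fundamental representation of the Lie algebra $\mathfrak{g}$ of type $G_2$ described in the context, with the quadratic form $B_{\mathfrak{g}}(x,y)=-\frac13\mathrm{Tr}(\rho(x)\rho(y))$ on $\mathfrak{g}$. The moment map $\mu_{\mathrm{Im}}: \Lambda^2(\mathrm{Im}(\mathbb{O}))\rightarrow \mathfrak{g}$ of this representation satisfies $$\mu_{\mathrm{Im}}(u,v)(w)=-\frac{1}{4}\big([w,[u,v]]+3(u,v,w)\big)\qquad\forall u,v,w\in \mathrm{Im}(\mathbb{O}).$$
   Context: $\mathbb{O}$ is an octonion (Cayley) algebra over $k$, i.e. an $8$-dimensional unital composition algebra, with norm $q$ and conjugation $u\mapsto\bar u$, $q(u)=u\bar u$; $\mathrm{Im}(\mathbb{O})=\{u\in\mathbb{O}: \bar u=-u\}$; $B$ is the symmetric bilinear form with $B(u,u)=q(u)$. The commutator is $[u,v]=uv-vu$ and the associator is $(u,v,w)=(uv)w-u(vw)$. Left multiplication $\rho(u)(x)=ux$ ($u\in\mathrm{Im}(\mathbb{O})$, $x\in\mathbb{O}$) satisfies $\rho(u)^2=-q(u)\mathrm{Id}$, hence extends to an algebra morphism $\rho:C(\mathrm{Im}(\mathbb{O}),-q)\to\mathrm{End}(\mathbb{O})$ from the Clifford algebra (in which $u^2=-q(u)$). Let $C^2(\mathrm{Im}(\mathbb{O}),-q)$ be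 the span of the elements $uv-vu$ with $u,v\in\mathrm{Im}(\mathbb{O})$, a Lie algebra under the commutator. Set $\mathfrak{g}=\{x\in C^2(\mathrm{Im}(\mathbb{O}),-q): \rho(x)(1)=0\}$. It is a Lie algebra of type $G_2$, $\rho(\mathfrak{g})$ is the Lie algebra of derivations of $\mathbb{O}$, and by restriction to $\mathrm{Im}(\mathbb{O})$ one gets $\rho:\mathfrak{g}\to\mathfrak{so}(\mathrm{Im}(\mathbb{O}),B)$. The moment map $\mu_{\mathrm{Im}}$ is the alternating map determined by $B_{\mathfrak{g}}(x,\mu_{\mathrm{Im}}(u,v))=B(\rho(x)(u),v)$ for all $x\in\mathfrak{g}$, $u,v\in\mathrm{Im}(\mathbb{O})$; $\mu_{\mathrm{Im}}(u,v)(w)$ means $\rho(\mu_{\mathrm{Im}}(u,v))(w)$. *)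

(* Defs.v *)
From HB Require Import structures.
From mathcomp Require Import all_boot all_order all_algebra.
From mathcomp Require Import boolp ring.

Set Implicit Arguments.
Unset Strict Implicit.
Unset Printing Implicit Defensive.

Import GRing.Theory.
Local Open Scope ring_scope.
Local Open Scope quotient_scope.

Definition polar (k : fieldType) (V : lmodType k) (q : V -> k) (u v : V) : k :=
  q (u + v) - q u - q v.

(* 8-dimensional unital composition algebras (the product need not be
   associative, so the ring structures of the library do not apply). *)
Record octonionAlgebra (k : fieldType) := OctonionAlgebra {
  oct_sort :> vectType k;
  omul : {bilinear oct_sort -> oct_sort -> oct_sort};
  oone : oct_sort;
  oq : oct_sort -> k;
  omul1l : forall x, omul oone x = x;
  omul1r : forall x, omul x oone = x;
  oqZ : forall a x, oq (a *: x) = a ^+ 2 * oq x;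
  oq_polar : forall a x y z,
    polar oq (a *: x + y) z = a * polar oq x z + polar oq y z;
  oq_nondegenerate : forall x, (forall y, polar oq x y = 0) -> x = 0;
  oqM : forall x y, oq (omul x y) = oq x * oq y;
  oct_dim : \dim {: oct_sort} = 8
}.

Section Octonions.
Variables (k : fieldType) (O : octonionAlgebra k).
Implicit Types (u v w x y z : O) (a b : k).

Definition conjO u : O := polar (@oq k O) u (oone O) *: oone O - u.

Definition oB u v : k := 2%:R^-1 * polar (@oq k O) u v.

Definition ocomm u v : O := omul O u v - omul O v u.

Definition oassoc u v w : O := omul O (omul O u v) w - omul O u (omul O v w).

Definition conjD u : O := conjO u + u.

Definition imO : {vspace O} := lker (linfun conjD).

Definition ImO : vectType k := subvs_of imO.

Lemma polarC u v : polar (@oq k O) u v = polar (@oq k O) v u.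
Proof. by rewrite /polar [u + v]addrC addrAC. Qed.

Lemma polarDr x y z :
  polar (@oq k O) x (y + z) = polar (@oq k O) x y + polar (@oq k O) x z.
Proof.
by rewrite polarC -[y]scale1r oq_polar mul1r scale1r !(polarC x).
Qed.

Lemma polarZr a x y : polar (@oq k O) x (a *: y) = a * polar (@oq k O) x y.
Proof.
have p0 z : polar (@oq k O) 0 z = 0.
  have := oq_polar 1 (0 : O) 0 z.
  rewrite scale1r addr0 mul1r => /eqP.
  by rewrite -subr_eq0 opprD addrA subrr add0r oppr_eq0 => /eqP.
by rewrite polarC -[a *: y]addr0 oq_polar p0 addr0 polarC.
Qed.

Lemma polarBr x y z :
  polar (@oq k O) x (y - z) = polar (@oq k O) x y - polar (@oq k O) x z.
Proof. by rewrite polarDr -scaleN1r polarZr mulN1r. Qed.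

Fact conjD_linear : linear conjD.
Proof.
move=> a u v; rewrite /conjD /conjO oq_polar !subrK.
by rewrite scalerDl scalerA.
Qed.

HB.instance Definition _ :=
  GRing.isLinear.Build k O O *:%R conjD conjD_linear.

Lemma mem_imO u : (u \in imO) = (conjO u == - u).
Proof. by rewrite memv_ker lfunE /= addr_eq0. Qed.

Lemma oq_polarM u x y :
  polar (@oq k O) (omul O u x) (omul O u y) = oq u * polar (@oq k O) x y.
Proof. by rewrite /polar -linearDr !oqM !mulrBr. Qed.

Lemma oq_polarMM u v x y :
  polar (@oq k O) (omul O u x) (omul O v y)
    + polar (@oq k O) (omul O v x) (omul O u y)
  = polar (@oq k O) u v * polar (@oq k O) x y.
Proof.
have := oq_polarM (u + v) x y.
rewrite !linearDl polarDr !(polarC (_ + _)) !polarDr.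
rewrite !(polarC _ (omul O _ x)) !oq_polarM.
have -> : oq (u + v) = polar (@oq k O) u v + oq u + oq v.
  by rewrite /polar; ring.
move/eqP; rewrite -subr_eq0 => /eqP h.
by apply/eqP; rewrite -subr_eq0 -{}h; apply/eqP; ring.
Qed.

Lemma polar_conjM u x y :
  polar (@oq k O) x (omul O (conjO u) y) = polar (@oq k O) (omul O u x) y.
Proof.
rewrite /conjO linearBl linearZl_LR /= omul1l polarBr polarZr.
by rewrite -oq_polarMM !omul1l addrK.
Qed.

Lemma conj_mulK u x : omul O (conjO u) (omul O u x) = oq u *: x.
Proof.
apply/eqP; rewrite -subr_eq0; apply/eqP/oq_nondegenerate => y.
rewrite polarC polarBr polar_conjM oq_polarM polarZr.
by rewrite subrr.
Qed.

Lemma oq_conj u : omul O (conjO u) u = oq u *: oone O.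
Proof. by have := conj_mulK u (oone O); rewrite omul1r. Qed.

Lemma omul_im (u : ImO) x :
  omul O (vsval u) (omul O (vsval u) x) = - oq (vsval u) *: x.
Proof.
have /eqP cu : conjO (vsval u) == - vsval u by rewrite -mem_imO subvsP.
by rewrite scaleNr -conj_mulK cu linearNl opprK.
Qed.

End Octonions.

(* The Clifford algebra of (V, Q) is the quotient of the set of formal algebra
   expressions on V by the least congruence that makes it an associative unital
   k-algebra, with [TGen] linear and [TGen v * TGen v = Q v]. *)
Section CliffordQuotient.
Variables (k : fieldType) (V : lmodType k) (Q : V -> k).

Inductive cterm : Type :=
| TGen of V
| TScal of k
| TAdd of cterm & cterm
| TMul of cterm & cterm.

Inductive crel : cterm -> cterm -> Prop :=
| CRefl s : crel s s
| CSym s t : crel s t -> crel t s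
| CTrans s t r : crel s t -> crel t r -> crel s r
| CAdd s s' t t' : crel s s' -> crel t t' -> crel (TAdd s t) (TAdd s' t')
| CMul s s' t t' : crel s s' -> crel t t' -> crel (TMul s t) (TMul s' t')
| CAddA s t r : crel (TAdd s (TAdd t r)) (TAdd (TAdd s t) r)
| CAddC s t : crel (TAdd s t) (TAdd t s)
| CAdd0 s : crel (TAdd (TScal 0) s) s
| CAddN s : crel (TAdd (TMul (TScal (-1)) s) s) (TScal 0)
| CMulA s t r : crel (TMul s (TMul t r)) (TMul (TMul s t) r)
| CMul1 s : crel (TMul (TScal 1) s) s
| CMulDl s t r : crel (TMul (TAdd s t) r) (TAdd (TMul s r) (TMul t r))
| CMulDr s t r : crel (TMul r (TAdd s t)) (TAdd (TMul r s) (TMul r t))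
| CScalD a b : crel (TScal (a + b)) (TAdd (TScal a) (TScal b))
| CScalM a b : crel (TScal (a * b)) (TMul (TScal a) (TScal b))
| CScalC a s : crel (TMul (TScal a) s) (TMul s (TScal a))
| CGenD u v : crel (TGen (u + v)) (TAdd (TGen u) (TGen v))
| CGenZ a u : crel (TGen (a *: u)) (TMul (TScal a) (TGen u))
| CSquare u : crel (TMul (TGen u) (TGen u)) (TScal (Q u)).

HB.instance Definition _ := gen_eqMixin cterm.
HB.instance Definition _ := gen_choiceMixin cterm.

Definition crelb (s t : cterm) : bool := `[< crel s t >].

Fact crelb_refl : reflexive crelb.
Proof. by move=> s; apply/asboolP/CRefl. Qed.
Fact crelb_sym : symmetric crelb.
Proof. by move=> s t; apply/asboolP/asboolP => /CSym. Qed.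
Fact crelb_trans : transitive crelb.
Proof. by move=> t s r /asboolP st /asboolP tr; apply/asboolP/(CTrans st). Qed.
Canonical crelb_equiv := EquivRel crelb crelb_refl crelb_sym crelb_trans.

Definition cquot := {eq_quot crelb_equiv}.
HB.instance Definition _ : EqQuotient _ crelb_equiv cquot :=
  EqQuotient.on cquot.
HB.instance Definition _ := Choice.on cquot.

Definition cpi (t : cterm) : cquot := \pi_cquot t.

Lemma cpiP s t : cpi s = cpi t <-> crel s t.
Proof. by split=> [/eqquotP/asboolP|h] //; apply/eqquotP/asboolP. Qed.

Lemma crel_repr t : crel (repr (cpi t)) t.
Proof. by apply/cpiP; rewrite /cpi reprK. Qed.

Lemma cpi_ind (P : cquot -> Prop) : (forall t, P (cpi t)) -> forall x, P x.
Proof. by move=> h x; rewrite -[x]reprK; apply: h. Qed.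

Definition cadd (x y : cquot) := cpi (TAdd (repr x) (repr y)).
Definition cmul (x y : cquot) := cpi (TMul (repr x) (repr y)).
Definition cscal (a : k) : cquot := cpi (TScal a).
Definition copp (x : cquot) := cmul (cscal (-1)) x.
Definition cscale (a : k) (x : cquot) := cmul (cscal a) x.
Definition cgen_quot (u : V) : cquot := cpi (TGen u).

Lemma cadd_pi s t : cadd (cpi s) (cpi t) = cpi (TAdd s t).
Proof. by apply/cpiP/CAdd; apply: crel_repr. Qed.
Lemma cmul_pi s t : cmul (cpi s) (cpi t) = cpi (TMul s t).
Proof. by apply/cpiP/CMul; apply: crel_repr. Qed.

Fact caddA : associative cadd.
Proof.
elim/cpi_ind=> s; elim/cpi_ind=> t; elim/cpi_ind=> r.
by rewrite !cadd_pi; apply/cpiP/CAddA.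
Qed.
Fact caddC : commutative cadd.
Proof.
by elim/cpi_ind=> s; elim/cpi_ind=> t; rewrite !cadd_pi; apply/cpiP/CAddC.
Qed.
Fact cadd0 : left_id (cscal 0) cadd.
Proof. by elim/cpi_ind=> s; rewrite cadd_pi; apply/cpiP/CAdd0. Qed.
Fact caddN : left_inverse (cscal 0) copp cadd.
Proof.
by elim/cpi_ind=> s; rewrite /copp cmul_pi cadd_pi; apply/cpiP/CAddN.
Qed.
Fact cmulA : associative cmul.
Proof.
elim/cpi_ind=> s; elim/cpi_ind=> t; elim/cpi_ind=> r.
by rewrite !cmul_pi; apply/cpiP/CMulA.
Qed.
Fact cscalC a x : cmul (cscal a) x = cmul x (cscal a).
Proof. by elim/cpi_ind: x => s; rewrite !cmul_pi; apply/cpiP/CScalC. Qed.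
Fact cmul1 : left_id (cscal 1) cmul.
Proof. by elim/cpi_ind=> s; rewrite cmul_pi; apply/cpiP/CMul1. Qed.
Fact cmulr1 : right_id (cscal 1) cmul.
Proof. by move=> x; rewrite -cscalC cmul1. Qed.
Fact cmulDl : left_distributive cmul cadd.
Proof.
elim/cpi_ind=> s; elim/cpi_ind=> t; elim/cpi_ind=> r.
by rewrite cadd_pi !cmul_pi cadd_pi; apply/cpiP/CMulDl.
Qed.
Fact cmulDr : right_distributive cmul cadd.
Proof.
elim/cpi_ind=> s; elim/cpi_ind=> t; elim/cpi_ind=> r.
by rewrite cadd_pi !cmul_pi cadd_pi; apply/cpiP/CMulDr.
Qed.
Fact cscalD a b : cscal (a + b) = cadd (cscal a) (cscal b).
Proof. by rewrite cadd_pi; apply/cpiP/CScalD. Qed.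
Fact cscalM a b : cscal (a * b) = cmul (cscal a) (cscal b).
Proof. by rewrite cmul_pi; apply/cpiP/CScalM. Qed.

HB.instance Definition _ := GRing.isZmodule.Build cquot caddA caddC cadd0 caddN.

Fact cscaleA a b x : cscale a (cscale b x) = cscale (a * b) x.
Proof. by rewrite /cscale cscalM cmulA. Qed.
Fact cscale1 : left_id 1 cscale.
Proof. exact: cmul1. Qed.
Fact cscaleDr : right_distributive cscale +%R.
Proof. by move=> a x y; apply: cmulDr. Qed.
Fact cscaleDl x : {morph cscale^~ x : a b / a + b}.
Proof. by move=> a b; rewrite /cscale cscalD; apply: cmulDl. Qed.

HB.instance Definition _ := GRing.Zmodule_isLmodule.Build k cquot
  cscaleA cscale1 cscaleDr cscaleDl.

Fact cgen_linear : linear cgen_quot.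
Proof.
move=> a u v; apply/esym; rewrite /GRing.add /= /GRing.scale /=.
rewrite /cscale /cscal /cgen_quot cmul_pi cadd_pi; apply/cpiP.
apply/CSym/(CTrans (CGenD _ _))/CAdd; [exact: CGenZ | exact: CRefl].
Qed.

Fact cgen_square u : cmul (cgen_quot u) (cgen_quot u) = cscal (Q u).
Proof. by rewrite cmul_pi; apply/cpiP/CSquare. Qed.

End CliffordQuotient.

Section Representation.
Variables (k : fieldType) (O : octonionAlgebra k).

Definition cliffordO := cquot (fun u : ImO O => - oq (vsval u)).

Fixpoint cact (t : cterm (ImO O)) : 'End(O) :=
  match t with
  | TGen u => linfun (omul O (vsval u))
  | TScal a => a *: \1%VF
  | TAdd s t => cact s + cact t
  | TMul s t => (cact s \o cact t)%VF
  end.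

Lemma crel_cact s t :
  crel (fun u : ImO O => - oq (vsval u)) s t -> cact s = cact t.
Proof.
elim=> {s t} /=.
- by [].
- by [].
- by move=> s t r _ -> _ ->.
- by move=> s s' t t' _ -> _ ->.
- by move=> s s' t t' _ -> _ ->.
- by move=> s t r; rewrite addrA.
- by move=> s t; rewrite addrC.
- by move=> s; rewrite scale0r add0r.
- by move=> s; rewrite scale0r -comp_lfunZl comp_lfun1l scaleN1r addNr.
- by move=> s t r; rewrite comp_lfunA.
- by move=> s; rewrite scale1r comp_lfun1l.
- by move=> s t r; rewrite comp_lfunDl.
- by move=> s t r; rewrite comp_lfunDr.
- by move=> a b; rewrite scalerDl.
- by move=> a b; rewrite -comp_lfunZl comp_lfun1l scalerA.
- by move=> a s; rewrite -comp_lfunZl -comp_lfunZr comp_lfun1l comp_lfun1r.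
- move=> u v; apply/lfunP=> x; rewrite !lfunE /= !lfunE /=.
  by rewrite linearDl.
- move=> a u; apply/lfunP=> x; rewrite -comp_lfunZl comp_lfun1l.
  by rewrite !lfunE /= !lfunE /= linearZl_LR.
- move=> u; apply/lfunP=> x.
  by rewrite !lfunE /= !lfunE /= omul_im.
Qed.

Definition rho (x : cliffordO) : 'End(O) := cact (repr x).

Lemma rho_pi t : rho (cpi _ t) = cact t.
Proof. exact/crel_cact/crel_repr. Qed.

HB.instance Definition _ := GRing.Lmodule.on cliffordO.

Fact clifford1_neq0 : cscal _ 1 != 0 :> cliffordO.
Proof.
apply/eqP=> /(congr1 rho); rewrite rho_pi [RHS]rho_pi /= scale1r scale0r.
move/lfunP/(_ _); move: (oct_dim O) => d8 h.
have : ({: O} <= 0)%VS.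
  by apply/subvP=> x _; rewrite memv0 -[x]id_lfunE h zero_lfunE.
by move/dimvS; rewrite d8 dimv0.
Qed.

HB.instance Definition _ := GRing.Zmodule_isNzRing.Build cliffordO
  (@cmulA _ _ _) (@cmul1 _ _ _) (@cmulr1 _ _ _) (@cmulDl _ _ _) (@cmulDr _ _ _)
  clifford1_neq0.

Fact cliffordO_scalerAl (a : k) (x y : cliffordO) : a *: (x * y) = (a *: x) * y.
Proof. exact: cmulA. Qed.

HB.instance Definition _ :=
  GRing.Lmodule_isLalgebra.Build k cliffordO cliffordO_scalerAl.

Fact cliffordO_scalerAr (a : k) (x y : cliffordO) : a *: (x * y) = x * (a *: y).
Proof.
by rewrite /GRing.scale /= /cscale /GRing.mul /= !cmulA cscalC.
Qed.

HB.instance Definition _ :=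
  GRing.Lalgebra_isAlgebra.Build k cliffordO cliffordO_scalerAr.

Definition cgen (u : ImO O) : cliffordO := cgen_quot _ u.

HB.instance Definition _ := GRing.isLinear.Build k (ImO O) cliffordO *:%R cgen
  (@cgen_linear _ _ _).

Lemma cgen_sqr (u : ImO O) : cgen u ^+ 2 = (- oq (vsval u))%:A.
Proof.
rewrite expr2 [LHS]cgen_square /GRing.scale /= /cscale /GRing.one /=.
by rewrite cmulr1.
Qed.

Fact rho_linear : linear rho.
Proof.
move=> a; elim/cpi_ind=> s; elim/cpi_ind=> t.
rewrite {1}/GRing.add /= {1}/GRing.scale /= /cscale cmul_pi cadd_pi !rho_pi /=.
by rewrite -comp_lfunZl comp_lfun1l.
Qed.

HB.instance Definition _ :=
  GRing.isLinear.Build k cliffordO 'End(O) *:%R rho rho_linear.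

Lemma rho_gen (u : ImO O) x : rho (cgen u) x = omul O (vsval u) x.
Proof. by rewrite rho_pi lfunE. Qed.

Lemma rho1 : rho 1 = \1%VF.
Proof. by rewrite rho_pi /= scale1r. Qed.

Lemma rhoM x y : rho (x * y) = (rho x \o rho y)%VF.
Proof.
elim/cpi_ind: x => s; elim/cpi_ind: y => t.
by rewrite {1}/GRing.mul /= cmul_pi !rho_pi.
Qed.

Definition in_C2 (x : cliffordO) : Prop :=
  exists (n : nat) (a : 'I_n -> k) (u v : 'I_n -> ImO O),
    x = \sum_(i < n) a i *: (cgen (u i) * cgen (v i) - cgen (v i) * cgen (u i)).

Definition in_g (x : cliffordO) : Prop := in_C2 x /\ rho x (oone O) = 0.

(* For x in g, [rho x] preserves Im(O), and [rho_im x] is its restriction;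
   for other x it is a compression by the projection [vsproj]. *)
Definition rho_im (x : cliffordO) : 'End(ImO O) :=
  (linfun (vsproj (imO O)) \o rho x \o linfun vsval)%VF.

Definition trace (V : vectType k) (f : 'End(V)) : k :=
  \tr (passmx.mxof (vbasis fullv) (vbasis fullv) f).

Definition Bg (x y : cliffordO) : k :=
  - 3%:R^-1 * trace (rho_im x \o rho_im y)%VF.

(* Alternating bilinear maps on Im(O) encode linear maps on its second exterior
   power. *)
Definition moment_map (mu : {bilinear ImO O -> ImO O -> cliffordO}) : Prop :=
  [/\ forall u v, in_g (mu u v),
      forall u, mu u u = 0
    & forall x u v, in_g x ->
        Bg x (mu u v) = oB (rho x (vsval u)) (vsval v)].

End Representation.

(* Main.v *)
Require Import Defs.
From HB Require Import structures.
From mathcomp Require Import all_boot all_order all_algebra.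
From mathcomp Require Import ring.

(** Write L_u and R_u for left and right multiplication by u.  In any
    alternative algebra

      D_(u,v) = [L_u, L_v] + [R_u, R_v] + [L_u, R_v]

    is a derivation, and D_(u,v) w = [[u,v],w] - 3 (u,v,w); up to the factor
    1/4 this is the right-hand side of the theorem.  So the claim is that
    the moment map is D/4.

    The moment identity is a trace computation.  For a derivation X one has
    [X, L_u] = L_(Xu) and [X, R_u] = R_(Xu), so Tr (X [A, B]) =
    Tr ([X, A] B) turns Tr (X D_(u,v)) into traces of products of two
    multiplications ([trace_opbrk]).  For imaginary a and b these are
    -8 B(a,b) for L_a L_b and R_a R_b, and 4 B(a,b) for L_a R_b
    ([trace_lop2], [trace_rop2], [trace_lrop]); hence
    Tr (X D_(u,v)) = -12 B(Xu,v) ([trace_inner_der]), which the factor -1/3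
    of the form on g and the factor 1/4 normalize to B(Xu,v).  Elements of g
    act as derivations because the commutator of an element of C^2 with a
    generator w is again a generator w', and evaluation at 1 identifies w'
    with the image of w ([g_derivation]).

    For the moment map to exist, D_(u,v) must come from an element of C^2
    that depends bilinearly on u and v.  For a skew derivation f, a basis b_i
    of O and its dual basis d_i, the element
    [casimir] f = sum_i (d_i f(b_i) - f(b_i) d_i) of C^2, taken on imaginary
    parts, has the same commutators with the generators as 4 f.  So it acts
    as 4 f as soon as it kills 1, and its value at 1 is an imaginary element e
    with B(e, [u,v]) = 0 for all u and v, by the trace formulas again.  Then e
    is central, so L_e = R_e, and comparing Tr (L_u L_e) with Tr (L_u R_e)
    gives 12 B(u,e) = 0 for all imaginary u, whence e = 0
    ([imag_central], [rho_casimir1], [rho_casimirE]).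

    Uniqueness of the action follows from the symmetry of the form on g: if
    mu is the moment map just built and nu is any other, then
    B(rho(nu(u,v)) w, t) = Bg(nu(u,v), mu(w,t)) = Bg(mu(w,t), nu(u,v))
    = B(rho(mu(w,t)) u, v), which does not involve nu
    ([moment_map_unique]). *)

Set Implicit Arguments.
Unset Strict Implicit.
Unset Printing Implicit Defensive.

Import GRing.Theory.
Local Open Scope ring_scope.

(** * The trace of an endomorphism *)

Section Trace.
Variable k : fieldType.
Implicit Types V W : vectType k.

Lemma traceE V (f : 'End(V)) :
  trace f = \sum_i coord (vbasis fullv) i (f (vbasis fullv)`_i).
Proof.
rewrite /trace /mxtrace; apply: eq_bigr => i _.
by rewrite !mxE /= passmx.vecof_delta.
Qed.

Lemma trace_linear V : linear_for *%R (@trace k V).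
Proof.
move=> a f g; rewrite !traceE mulr_sumr -big_split; apply: eq_bigr => i _.
by rewrite !lfunE /= !lfunE /= linearP.
Qed.

HB.instance Definition _ V :=
  GRing.isLinear.Build k 'End(V) k *%R (@trace k V) (@trace_linear V).

Lemma trace_compC V W (f : 'Hom(V, W)) (g : 'Hom(W, V)) :
  trace (f \o g)%VF = trace (g \o f)%VF.
Proof.
have fB (U : vectType k) : basis_of {:U} (vbasis {:U}) by exact: vbasisP.
by rewrite /trace !(passmx.mxof_comp _ _ (fB _)) mxtrace_mulC.
Qed.

Lemma trace_id V : trace (\1%VF : 'End(V)) = (\dim {:V})%:R.
Proof.
rewrite traceE -[in RHS](card_ord (\dim _)) -sum1_card natr_sum.
apply: eq_bigr => i _; rewrite id_lfunE coord_free ?eqxx //.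
exact/basis_free/vbasisP.
Qed.

End Trace.

(** * Composition algebras are alternative *)

Section Octonion.
Variables (k : fieldType) (O : octonionAlgebra k).
Implicit Types (u v w x y z : O) (a b : k) (X f g h : 'End(O)).

Local Notation P := (polar (@oq k O)).
Local Notation "x ** y" := (omul O x y) (at level 40, left associativity).
Local Notation e1 := (oone O).

Lemma polar_inj x y : (forall z, P x z = P y z) -> x = y.
Proof.
move=> h; apply/eqP; rewrite -subr_eq0; apply/eqP/oq_nondegenerate => z.
by rewrite polarC polarBr !(polarC z) h subrr.
Qed.

Lemma polarDl x y z : P (x + y) z = P x z + P y z.
Proof. by rewrite !(polarC _ z) polarDr. Qed.
Lemma polarZl a x z : P (a *: x) z = a * P x z.
Proof. by rewrite !(polarC _ z) polarZr. Qed.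
Lemma polarNl x z : P (- x) z = - P x z.
Proof. by rewrite -scaleN1r polarZl mulN1r. Qed.
Lemma polarNr x z : P x (- z) = - P x z.
Proof. by rewrite polarC polarNl polarC. Qed.
Lemma polar0l z : P 0 z = 0.
Proof. by rewrite -[0](scale0r e1) polarZl mul0r. Qed.
Definition polarE := (polarDl, polarNl, polarZl, polar0l).

Lemma omulDl x y z : (x + y) ** z = x ** z + y ** z.
Proof. exact: linearDl. Qed.
Lemma omulDr x y z : z ** (x + y) = z ** x + z ** y.
Proof. exact: linearDr. Qed.
Lemma omulNl x z : (- x) ** z = - (x ** z). Proof. exact: linearNl. Qed.
Lemma omulNr x z : z ** (- x) = - (z ** x). Proof. exact: linearNr. Qed.
Lemma omulZl a x z : (a *: x) ** z = a *: (x ** z).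
Proof. exact: linearZl_LR. Qed.
Lemma omulZr a x z : z ** (a *: x) = a *: (z ** x). Proof. exact: linearZr. Qed.
Lemma omul0l z : 0 ** z = 0. Proof. exact: linear0l. Qed.
Lemma omul0r z : z ** 0 = 0. Proof. exact: linear0r. Qed.
Definition omulE :=
  (omulDl, omulDr, omulNl, omulNr, omulZl, omulZr, @omul1l k O, @omul1r k O).

Lemma conjOE u : conjO u = P u e1 *: e1 - u. Proof. by []. Qed.

Lemma oone_neq0 : e1 != 0.
Proof.
apply/eqP => e0; have := oct_dim O.
suff -> : {: O}%VS = 0%VS by rewrite dimv0.
apply/eqP; rewrite -subv0; apply/subvP => x _.
by rewrite memv0 -[x]omul1l e0 omul0l.
Qed.

Lemma polar_diag x : P x x = 2 * oq x.
Proof. by rewrite /polar -[x]scale1r -scalerDl !oqZ; ring. Qed.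

Lemma oq1 : oq e1 = 1.
Proof.
have := conj_mulK e1 e1; rewrite conjOE !omulE polar_diag => /eqP.
rewrite -[e1 in X in _ - X]scale1r -scalerBl -subr_eq0 -scalerBl scaler_eq0.
rewrite (negPf oone_neq0) orbF => /eqP h; rewrite -[RHS]add0r -h; ring.
Qed.

Lemma polar11 : P e1 e1 = 2.
Proof. by rewrite polar_diag oq1 mulr1. Qed.

Lemma polar_mulr_conj x y u : P x (y ** conjO u) = P (x ** u) y.
Proof.
rewrite conjOE !omulE polarBr polarZr mulrC -oq_polarMM !omul1r.
by rewrite (polarC (y ** u)) addrK.
Qed.

Lemma mul_conjK u x : (x ** u) ** conjO u = oq u *: x.
Proof.
apply: polar_inj => y; rewrite polarC polar_mulr_conj polarC polarZl.
by rewrite {1}/polar -omulDl !oqM /polar; ring.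
Qed.

Lemma sqrO u : u ** u = P u e1 *: u - oq u *: e1.
Proof.
rewrite -(oq_conj u) conjOE; apply: polar_inj => z.
by rewrite !(omulE, polarE); ring.
Qed.

(** This is conj u * (u x) = q(u) x, rewritten with conj u = P(u,1) 1 - u and
    the quadratic equation [sqrO] of u. *)
Lemma alt_l u x : u ** (u ** x) = (u ** u) ** x.
Proof.
have := conj_mulK u x; rewrite conjOE sqrO !omulE => h.
by rewrite -h; apply: polar_inj => z; rewrite !(omulE, polarE); ring.
Qed.

Lemma alt_r u x : (x ** u) ** u = x ** (u ** u).
Proof.
have := mul_conjK u x; rewrite conjOE sqrO !omulE => h.
by rewrite -h; apply: polar_inj => z; rewrite !(omulE, polarE); ring.
Qed.

(** The coefficient a lets one known relation be subtracted from a goal with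
    any weight, after which only a ring identity in k is left. *)
Lemma polar_lin a x y x' y' : x' = y' ->
  (forall z, P x z - P y z = a * (P x' z - P y' z)) -> x = y.
Proof.
move=> -> h; apply: polar_inj => z; apply/eqP.
by rewrite -subr_eq0 h subrr mulr0.
Qed.

(* A linear identity between products is checked after pairing with an
   arbitrary vector, where it becomes a ring identity in k; by_combining a h
   subtracts a times the equation h beforehand. *)
Ltac by_expanding := apply: polar_inj => ?; rewrite ?(omulE, polarE); ring.
Ltac by_combining a h :=
  apply: (polar_lin (a := a) h) => ?; rewrite !(omulE, polarE); ring.

Lemma alt_l2 u v x : u ** (v ** x) + v ** (u ** x) = (u ** v + v ** u) ** x.
Proof.
have := alt_l (u + v) x; rewrite !omulE !alt_l => h; by_combining (1 : k) h.
Qed.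

Lemma alt_r2 u v x : (x ** u) ** v + (x ** v) ** u = x ** (u ** v + v ** u).
Proof.
have := alt_r (u + v) x; rewrite !omulE !alt_r => h; by_combining (1 : k) h.
Qed.

Lemma oassocCl u v x : oassoc v u x = - oassoc u v x.
Proof. by rewrite /oassoc; by_combining (-1 : k) (alt_l2 u v x). Qed.

Lemma oassocCr x u v : oassoc x v u = - oassoc x u v.
Proof. by rewrite /oassoc; by_combining (1 : k) (alt_r2 u v x). Qed.

Lemma oassoc_cyc u v x : oassoc u v x = oassoc x u v.
Proof. by rewrite (oassocCr u x v) (oassocCl x u v) opprK. Qed.

(** Polarization of the quadratic equation of x. *)
Lemma anticomm_mul x y :
  x ** y + y ** x = P x e1 *: y + P y e1 *: x - P x y *: e1.
Proof.
have := sqrO (x + y); rewrite !omulE !sqrO => h.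
apply: (polar_lin (a := 1) h) => z; rewrite !(omulE, polarE) /polar; ring.
Qed.

Definition imag u := P u e1 == 0.

Lemma imagP u : reflect (P u e1 = 0) (imag u). Proof. exact: eqP. Qed.

Lemma clifford_l u v x : imag u -> imag v ->
  u ** (v ** x) + v ** (u ** x) = - P u v *: x.
Proof.
move=> /imagP iu /imagP iv; rewrite alt_l2 anticomm_mul iu iv !scale0r !add0r.
by rewrite omulNl omulZl omul1l scaleNr.
Qed.

Lemma clifford_r u v x : imag u -> imag v ->
  (x ** u) ** v + (x ** v) ** u = - P u v *: x.
Proof.
move=> /imagP iu /imagP iv; rewrite alt_r2 anticomm_mul iu iv !scale0r !add0r.
by rewrite omulNr omulZr omul1r scaleNr.
Qed.

Lemma imag_conj u : imag u -> conjO u = - u.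
Proof. by move=> /imagP iu; rewrite conjOE iu scale0r add0r. Qed.

Lemma polar_mull u x y : imag u -> P (u ** x) y = - P x (u ** y).
Proof.
by move=> iu; rewrite -polar_conjM imag_conj // omulNl polarNr.
Qed.

Lemma polar_mulr u x y : imag u -> P (x ** u) y = - P x (y ** u).
Proof.
by move=> iu; rewrite -polar_mulr_conj imag_conj // omulNr polarNr.
Qed.

(** * Inner derivations *)

Definition rmul u x := x ** u.
Fact rmul_linear u : linear (rmul u).
Proof. by move=> a x y; rewrite /rmul omulDl omulZl. Qed.
HB.instance Definition _ u :=
  GRing.isLinear.Build k O O *:%R (rmul u) (rmul_linear u).

Definition lop u : 'End(O) := linfun (omul O u).
Definition rop u : 'End(O) := linfun (rmul u).
Definition opbrk f g : 'End(O) := ((f \o g)%VF - (g \o f)%VF).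

Lemma lopE u x : lop u x = u ** x. Proof. exact: lfunE. Qed.
Lemma ropE u x : rop u x = x ** u. Proof. exact: lfunE. Qed.
Lemma opbrkE f g x : opbrk f g x = f (g x) - g (f x).
Proof. by rewrite /opbrk add_lfunE opp_lfunE !comp_lfunE. Qed.
Lemma opaddE f g x : (f + g) x = f x + g x. Proof. exact: add_lfunE. Qed.
Lemma opoppE f x : (- f) x = - f x. Proof. exact: opp_lfunE. Qed.
Lemma opscaleE a f x : (a *: f) x = a *: f x. Proof. exact: scale_lfunE. Qed.
Lemma opcompE f g x : (f \o g)%VF x = f (g x). Proof. exact: comp_lfunE. Qed.
Definition opE := (lopE, ropE, opbrkE, opaddE, opoppE, opscaleE, opcompE).

(** The infinitesimal form of triality, f(xy) = g(x) y + x h(y). Such triples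
    form a Lie algebra, and those with f = g = h are the derivations. *)
Definition triple f g h := forall x y, f (x ** y) = g x ** y + x ** h y.

Lemma triple_opbrk f g h f' g' h' : triple f g h -> triple f' g' h' ->
  triple (opbrk f f') (opbrk g g') (opbrk h h').
Proof.
move=> t t' x y; rewrite !opE t' t !linearD /= !t !t'.
by_expanding.
Qed.

Lemma triple_add f g h f' g' h' : triple f g h -> triple f' g' h' ->
  triple (f + f') (g + g') (h + h').
Proof.
move=> t t' x y; rewrite !opE t' t.
by_expanding.
Qed.

(** The left alternative law (u,x,y) = -(x,u,y), sorted by the places where u
    occurs. *)
Lemma triple_lop u : triple (lop u) (lop u + rop u) (- lop u).
Proof.
move=> x y; rewrite !opE; have := oassocCl u x y; rewrite /oassoc => h.
by_combining (-1 : k) h.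
Qed.

Lemma triple_rop u : triple (rop u) (- rop u) (lop u + rop u).
Proof.
move=> x y; rewrite !opE; have := oassocCr x u y; rewrite /oassoc => h.
by_combining (1 : k) h.
Qed.

Definition inner_der u v : 'End(O) :=
  opbrk (lop u) (lop v) + opbrk (rop u) (rop v) + opbrk (lop u) (rop v).

Definition derivation f := triple f f f.

(** By definition [L_u, R_v] x = -(u,x,v); alternativity moves v inside. *)
Lemma opbrk_lr u v x : opbrk (lop u) (rop v) x = oassoc u v x.
Proof. rewrite !opE oassocCr /oassoc; by_expanding. Qed.

Lemma opbrk_lrC u v : opbrk (lop u) (rop v) = opbrk (rop u) (lop v).
Proof.
have e f g : opbrk f g = - opbrk g f by apply/lfunP => x; rewrite !opE opprB.
by apply/lfunP => x; rewrite (e (rop u)) opoppE !opbrk_lr oassocCl.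
Qed.

(** The three brackets in [inner_der] are first components of triples. Adding
    these triples makes the other two components equal to the first, because
    [L_u, R_v] = [R_u, L_v]. *)
Lemma inner_der_derivation u v : derivation (inner_der u v).
Proof.
have eLR := opbrk_lrC u v.
have bDl f g h : opbrk (f + g) h = opbrk f h + opbrk g h.
  apply/lfunP => x; rewrite !opE linearD /=; by_expanding.
have bDr f g h : opbrk h (f + g) = opbrk h f + opbrk h g.
  apply/lfunP => x; rewrite !opE linearD /=; by_expanding.
have bNl f g : opbrk (- f) g = - opbrk f g.
  apply/lfunP => x; rewrite !opE linearN /=; by_expanding.
have bNr f g : opbrk f (- g) = - opbrk f g.
  apply/lfunP => x; rewrite !opE linearN /=; by_expanding.
have tLL := triple_opbrk (triple_lop u) (triple_lop v).
have tRR := triple_opbrk (triple_rop u) (triple_rop v).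
have tLR := triple_opbrk (triple_lop u) (triple_rop v).
have := triple_add (triple_add tLL tRR) tLR.
rewrite -/(inner_der u v) !(bDl, bDr, bNl, bNr) -eLR => h x y; rewrite h.
by congr (_ ** y + x ** _); rewrite /inner_der !opE; by_expanding.
Qed.

Lemma derivation1 f : derivation f -> f e1 = 0.
Proof.
move=> df; have := df e1 e1; rewrite !omulE => /eqP.
by rewrite addrC -subr_eq subrr eq_sym => /eqP.
Qed.

Definition skew_adj f := forall x y, P (f x) y = - P x (f y).

Lemma skew_adj_opbrk f g : skew_adj f -> skew_adj g -> skew_adj (opbrk f g).
Proof.
move=> sf sg x y; rewrite !opE polarBr !polarE !(sf, sg); ring.
Qed.

Lemma skew_adj_inner_der u v : imag u -> imag v -> skew_adj (inner_der u v).
Proof.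
move=> iu iv x y.
have sL w : imag w -> skew_adj (lop w).
  by move=> iw ? ?; rewrite !opE polar_mull.
have sR w : imag w -> skew_adj (rop w).
  by move=> iw ? ?; rewrite !opE polar_mulr.
rewrite /inner_der 4!opaddE !polarDl !polarDr.
rewrite (skew_adj_opbrk (sL u iu) (sL v iv)).
rewrite (skew_adj_opbrk (sR u iu) (sR v iv)).
by rewrite (skew_adj_opbrk (sL u iu) (sR v iv)) !opprD.
Qed.

Lemma skew_imag f x : derivation f -> skew_adj f -> imag (f x).
Proof.
by move=> df sf; apply/imagP; rewrite sf derivation1 // polarC polar0l oppr0.
Qed.

Lemma lop_ocomm u v :
  lop (ocomm u v) = opbrk (lop u) (lop v) + 2 *: opbrk (lop u) (rop v).
Proof.
apply/lfunP => x; rewrite opaddE opscaleE opbrk_lr !opE /ocomm.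
have := oassocCl u v x; rewrite /oassoc => h; by_combining (-1 : k) h.
Qed.

Lemma rop_ocomm u v :
  rop (ocomm u v) = - opbrk (rop u) (rop v) - 2 *: opbrk (lop u) (rop v).
Proof.
apply/lfunP => x; rewrite opaddE opoppE opoppE opscaleE opbrk_lr !opE /ocomm.
rewrite oassoc_cyc.
have := oassocCr x u v; rewrite /oassoc => h; by_combining (1 : k) h.
Qed.

Lemma inner_derE u v w :
  inner_der u v w = - (ocomm w (ocomm u v) + 3%:R *: oassoc u v w).
Proof.
have -> : inner_der u v w =
    lop (ocomm u v) w - rop (ocomm u v) w - 3%:R *: oassoc u v w.
  rewrite -opbrk_lr lop_ocomm rop_ocomm /inner_der !opE.
  by_expanding.
by rewrite lopE ropE /ocomm; by_expanding.
Qed.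

Lemma inner_derDl a x y z :
  inner_der (a *: x + y) z = a *: inner_der x z + inner_der y z.
Proof. by apply/lfunP => w; rewrite !opE; by_expanding. Qed.

Lemma inner_derDr a x y z :
  inner_der z (a *: x + y) = a *: inner_der z x + inner_der z y.
Proof. by apply/lfunP => w; rewrite !opE; by_expanding. Qed.

Lemma inner_der_alt x : inner_der x x = 0.
Proof.
apply/lfunP => y; rewrite /inner_der 2!opaddE opbrk_lr /oassoc alt_l.
by rewrite zero_lfunE !opE; by_expanding.
Qed.

(** * Traces of products of multiplications *)

Local Notation basis := (vbasis {: O}).

Hypothesis two_neq0 : 2 != 0 :> k.

Lemma basis_sum x : \sum_i coord basis i x *: basis`_i = x.
Proof. by rewrite -coord_vbasis ?memvf. Qed.

Definition rank1 u v x := P x u *: v.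
Fact rank1_linear u v : linear (rank1 u v).
Proof. by move=> a x y; rewrite /rank1 !polarE scalerDl scalerA. Qed.
HB.instance Definition _ u v :=
  GRing.isLinear.Build k O O *:%R (rank1 u v) (rank1_linear u v).

Lemma trace_rank1 u v : trace (linfun (rank1 u v)) = P v u.
Proof.
rewrite traceE -[in RHS](basis_sum v) polarC.
rewrite (big_morph (P u) (polarDr u) (_ : P u 0 = 0)); last first.
  by rewrite polarC polar0l.
apply: eq_bigr => i _.
by rewrite lfunE /= /rank1 linearZ /= polarZr polarC mulrC.
Qed.

Lemma trace_idO : trace (\1%VF : 'End(O)) = 8.
Proof. by rewrite trace_id oct_dim. Qed.

(** Both f \o g and g \o f have the trace of half of their sum, a scalar
    operator on a space of dimension 8. *)
Lemma trace_anticomm f g a :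
  (forall x, f (g x) + g (f x) = - a *: x) -> trace (f \o g)%VF = - 4 * a.
Proof.
move=> fg; have : ((f \o g)%VF + (g \o f)%VF = - a *: \1)%VF.
  by apply/lfunP => x; rewrite !opE fg id_lfunE.
move/(congr1 (@trace _ _)); rewrite linearD linearZ /= trace_idO.
rewrite (trace_compC g) => e; apply: (mulfI two_neq0).
by rewrite mulr_natl mulr2n e; ring.
Qed.

Lemma trace_lop2 u v : imag u -> imag v ->
  trace (lop u \o lop v)%VF = - 4 * P u v.
Proof.
by move=> iu iv; apply: trace_anticomm => x; rewrite !opE clifford_l.
Qed.

Lemma trace_rop2 u v : imag u -> imag v ->
  trace (rop u \o rop v)%VF = - 4 * P u v.
Proof.
move=> iu iv; apply: trace_anticomm => x.
by rewrite !opE addrC clifford_r.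
Qed.

(** Exchanging x and v in x v by [anticomm_mul] turns L_u R_v into -L_u L_v
    plus two operators of rank one. *)
Lemma trace_lrop u v : imag u -> imag v ->
  trace (lop u \o rop v)%VF = 2 * P u v.
Proof.
move=> iu iv; have -> : (lop u \o rop v = linfun (rank1 e1 (u ** v))
    - linfun (rank1 v u) - (lop u \o lop v)%VF)%VF.
  apply/lfunP => x; rewrite !opE !lfunE /= /rank1.
  have /imagP v0 := iv; have := anticomm_mul x v; rewrite v0 scale0r addr0 => h.
  have := congr1 (omul O u) h => {}h; rewrite !omulE in h.
  by_combining (1 : k) h.
rewrite !linearB /= !trace_rank1 trace_lop2 //.
by rewrite polar_mull // omul1r polarC; ring.
Qed.

Lemma trace_opbrk X f g : trace (X \o opbrk f g)%VF = trace (opbrk X f \o g)%VF.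
Proof.
rewrite /opbrk comp_lfunDr comp_lfunDl comp_lfunNr comp_lfunNl !linearB /=.
by rewrite !comp_lfunA (trace_compC _ f) comp_lfunA.
Qed.

Lemma opbrk_derivation_lop X u : derivation X -> opbrk X (lop u) = lop (X u).
Proof. by move=> dX; apply/lfunP => x; rewrite !opE dX; by_expanding. Qed.

Lemma opbrk_derivation_rop X u : derivation X -> opbrk X (rop u) = rop (X u).
Proof. by move=> dX; apply/lfunP => x; rewrite !opE dX; by_expanding. Qed.

Lemma trace_inner_der X u v : derivation X -> (forall x, imag (X x)) ->
  imag u -> imag v -> trace (X \o inner_der u v)%VF = - 6 * P (X u) v.
Proof.
move=> dX iX iu iv; rewrite /inner_der 2!comp_lfunDr 2!linearD /= !trace_opbrk.
rewrite !opbrk_derivation_lop // opbrk_derivation_rop // trace_lop2 //.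
by rewrite trace_rop2 // trace_lrop //; ring.
Qed.

(** The contributions of [L_u, L_v] and of the associator to L_[u,v] cancel
    against each other. *)
Lemma trace_lop_ocomm X u v : derivation X -> (forall x, imag (X x)) ->
  imag u -> imag v -> trace (X \o lop (ocomm u v))%VF = 0.
Proof.
move=> dX iX iu iv; rewrite lop_ocomm comp_lfunDr -comp_lfunZr.
rewrite linearD linearZ /= !trace_opbrk !opbrk_derivation_lop //.
by rewrite trace_lop2 // trace_lrop //; ring.
Qed.

Lemma trace_rop_ocomm X u v : derivation X -> (forall x, imag (X x)) ->
  imag u -> imag v -> trace (X \o rop (ocomm u v))%VF = 0.
Proof.
move=> dX iX iu iv; rewrite rop_ocomm comp_lfunDr 2!comp_lfunNr -comp_lfunZr.
rewrite linearB linearN linearZ /= !trace_opbrk.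
rewrite !opbrk_derivation_lop // !opbrk_derivation_rop //.
by rewrite trace_rop2 // trace_lrop //; ring.
Qed.

Definition im_part x : O := x - (2^-1 * P x e1) *: e1.

Lemma imag_im_part x : imag (im_part x).
Proof.
by apply/imagP; rewrite !polarE polar11 mulrAC mulVf // mul1r subrr.
Qed.

Lemma im_decomp x : x = (2^-1 * P x e1) *: e1 + im_part x.
Proof. by rewrite addrC subrK. Qed.

Lemma nondegenerate_imag u : imag u -> (forall v, imag v -> P u v = 0) -> u = 0.
Proof.
move=> /imagP iu h; apply: oq_nondegenerate => x.
by rewrite (im_decomp x) polarDr polarZr iu mulr0 add0r h ?imag_im_part.
Qed.

Hypothesis three_neq0 : 3 != 0 :> k.

(** If e is central then L_e = R_e, whereas Tr (L_u L_e) = -4 P(u,e) and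
    Tr (L_u R_e) = 2 P(u,e). *)
Lemma imag_central e : imag e -> (forall x, e ** x = x ** e) -> e = 0.
Proof.
move=> ie ce; apply: nondegenerate_imag => // u iu.
have := trace_lrop iu ie; have -> : rop e = lop e.
  by apply/lfunP => x; rewrite !opE.
rewrite trace_lop2 // polarC => h.
apply: (mulfI (mulf_neq0 two_neq0 three_neq0)); rewrite mulr0.
by apply/eqP; rewrite -oppr_eq0 -[0](subrr (2 * P e u)) -{1}h; apply/eqP; ring.
Qed.

(** By nondegeneracy, sending x to its products with the basis vectors is
    injective, hence bijective for dimension reasons; its inverse maps unit
    vectors to the dual basis. *)
Fact dual_basis_exists :
  {d : 'I_(\dim {: O}) -> O | forall i x, P (d i) x = coord basis i x}.
Proof.
pose gram x : 'rV[k]_(\dim {: O}) := \row_j P x basis`_j.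
have gram_lin : linear gram.
  by move=> a x y; apply/rowP => j; rewrite !mxE !polarE.
pose gramL : {linear O -> 'rV_(\dim {: O})} :=
  HB.pack gram (GRing.isLinear.Build k O _ *:%R gram gram_lin).
pose G := linfun gramL.
have kerG : lker G == 0%VS.
  apply/lker0P => x y; rewrite !lfunE /= => /rowP exy.
  apply: polar_inj => z; rewrite -(basis_sum z).
  rewrite !(big_morph (P _) (polarDr _) (_ : P _ 0 = 0));
    try by rewrite polarC polar0l.
  by apply: eq_bigr => i _; rewrite !polarZr; have := exy i; rewrite !mxE => ->.
have imG r : r \in limg G.
  suff -> : limg G = fullv by rewrite memvf.
  apply/eqP; rewrite eqEdim subvf /= limg_dim_eq ?(eqP kerG) ?capv0 //.
  by rewrite dimvf /dim /= mul1n.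
exists (fun i => (G^-1)%VF (delta_mx 0 i)) => i x.
have := limg_lfunVK (imG (delta_mx 0 i)); rewrite lfunE /= => /rowP dG.
rewrite -[in LHS](basis_sum x).
rewrite (big_morph (P _) (polarDr _) (_ : P _ 0 = 0)); last first.
  by rewrite polarC polar0l.
rewrite (bigD1 i) //= big1 ?addr0 => [|j ji]; rewrite polarZr;
  have := dG (_ : 'I_ _); rewrite /gram.
- by move=> /(_ i); rewrite !mxE !eqxx => ->; rewrite mulr1.
- by move=> /(_ j); rewrite !mxE (negPf ji) andbF => ->; rewrite mulr0.
Qed.

Definition dual i : O := sval dual_basis_exists i.

Lemma polar_dual i x : P (dual i) x = coord basis i x.
Proof. exact: (svalP dual_basis_exists). Qed.

Lemma sum_polar_dual x : \sum_i P (dual i) x *: basis`_i = x.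
Proof.
by rewrite -[RHS]basis_sum; apply: eq_bigr => i _; rewrite polar_dual.
Qed.

Lemma polar_suml I (r : seq I) (F : I -> O) z :
  P (\sum_(i <- r) F i) z = \sum_(i <- r) P (F i) z.
Proof.
apply: (big_morph (P^~ z)); last exact: polar0l.
by move=> x y; exact: polarDl.
Qed.

Lemma sum_polar_basis x : \sum_(i < \dim {: O}) P basis`_i x *: dual i = x.
Proof.
apply: polar_inj => z; rewrite polar_suml -[in RHS](sum_polar_dual z).
rewrite [RHS]polarC polar_suml; apply: eq_bigr => i _.
by rewrite !polarZl mulrC.
Qed.

Lemma trace_dual f : trace f = \sum_i P (dual i) (f basis`_i).
Proof. by rewrite traceE; apply: eq_bigr => i _; rewrite polar_dual. Qed.

(** * The Clifford algebra and its spin action *)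

Lemma mem_imO_imag u : (u \in imO O) = imag u.
Proof.
rewrite mem_imO /imag conjOE -subr_eq0 opprK subrK scaler_eq0.
by rewrite (negPf oone_neq0) orbF.
Qed.

Lemma imag_vsval (u : ImO O) : imag (vsval u).
Proof. by rewrite -mem_imO_imag subvsP. Qed.

Lemma im_part_imag x : imag x -> im_part x = x.
Proof. by move=> /imagP x0; rewrite /im_part x0 mulr0 scale0r subr0. Qed.

Lemma im_part_linear : linear im_part.
Proof. by move=> a x y; rewrite /im_part; by_expanding. Qed.

HB.instance Definition _ :=
  GRing.isLinear.Build k O O *:%R im_part im_part_linear.

Definition im_proj x : ImO O := vsproj (imO O) (im_part x).

Lemma vsval_im_proj x : vsval (im_proj x) = im_part x.
Proof. by rewrite vsprojK // mem_imO_imag imag_im_part. Qed.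

Lemma im_proj_linear : linear im_proj.
Proof. by move=> a x y; rewrite /im_proj !linearP. Qed.

HB.instance Definition _ :=
  GRing.isLinear.Build k O (ImO O) *:%R im_proj im_proj_linear.

Definition cliff_brk (u v : ImO O) : cliffordO O :=
  cgen u * cgen v - cgen v * cgen u.

Lemma rho_cliff_brk (u v : ImO O) :
  rho (cliff_brk u v) = opbrk (lop (vsval u)) (lop (vsval v)).
Proof.
apply/lfunP => x; rewrite linearB /= !rhoM !opE.
by rewrite !rho_gen.
Qed.

(** Only the Clifford relations are used: moving w past u and v leaves the two
    scalar products. *)
Lemma opbrk_clifford u v w x : imag u -> imag v -> imag w ->
  opbrk (opbrk (lop u) (lop v)) (lop w) x =
  (2 * P u w *: v - 2 * P v w *: u) ** x.
Proof.
move=> iu iv iw; rewrite !opE.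
have uw y : u ** (w ** y) = - P u w *: y - w ** (u ** y).
  by rewrite -(clifford_l y iu iw) addrK.
have vw y : v ** (w ** y) = - P v w *: y - w ** (v ** y).
  by rewrite -(clifford_l y iv iw) addrK.
by rewrite !(uw, vw, omulE); by_expanding.
Qed.

Lemma omul_suml n (F : 'I_n -> O) x : (\sum_i F i) ** x = \sum_i F i ** x.
Proof.
apply: (big_morph (fun y => y ** x)); last exact: omul0l.
by move=> y z; exact: omulDl.
Qed.

Lemma C2_opbrk_lop (c : cliffordO O) w : in_C2 c -> imag w ->
  exists2 w', imag w' & forall x, opbrk (rho c) (lop w) x = w' ** x.
Proof.
move=> [n [a [u [v ->]]]] iw.
exists (\sum_i a i *: (2 * P (vsval (u i)) w *: vsval (v i)
                       - 2 * P (vsval (v i)) w *: vsval (u i))).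
  apply/imagP; rewrite polar_suml big1 // => i _.
  have /imagP ui := imag_vsval (u i); have /imagP vi := imag_vsval (v i).
  by rewrite !polarE ui vi; ring.
move=> x; rewrite omul_suml !opE linear_sum !sum_lfunE linear_sumr -sumrB.
apply: eq_bigr => i _.
rewrite linearZ /= rho_cliff_brk !opscaleE !omulE -scalerBr.
have := opbrk_clifford x (imag_vsval (u i)) (imag_vsval (v i)) iw.
by rewrite opbrkE !opE !omulE => ->.
Qed.

(** The vector w' of [C2_opbrk_lop] is found by evaluation at 1, which elements
    of g kill. *)
Lemma g_opbrk_lop (c : cliffordO O) w : in_g c -> imag w ->
  imag (rho c w) /\ forall x, opbrk (rho c) (lop w) x = rho c w ** x.
Proof.
move=> [c2 c1] iw; have [w' iw' cw'] := C2_opbrk_lop c2 iw.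
have := cw' e1; rewrite !opE c1 omul0r subr0 !omul1r => ew.
by rewrite ew.
Qed.

Lemma g_imag (c : cliffordO O) x : in_g c -> imag (rho c x).
Proof.
move=> gc; have [_ c1] := gc; rewrite (im_decomp x) linearP /= c1 scaler0 add0r.
by have [] := g_opbrk_lop gc (imag_im_part x).
Qed.

Lemma g_derivation (c : cliffordO O) : in_g c -> derivation (rho c).
Proof.
move=> gc x y; have [_ c1] := gc; have [_ h] := g_opbrk_lop gc (imag_im_part x).
have := h y; rewrite !opE => {}h.
rewrite (im_decomp x) !omulE !linearP /= c1 scaler0 add0r.
by_combining (1 : k) h.
Qed.

(** The inverse, up to the factor 4, of the spin action on derivations: the
    element of the second exterior power that represents f as a skew
    operator. *)
Definition casimir f : cliffordO O :=
  \sum_(i < \dim {: O}) cliff_brk (im_proj (dual i)) (im_proj (f basis`_i)).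

Lemma rho_casimir f x : (forall y, imag (f y)) ->
  rho (casimir f) x =
  \sum_(i < \dim {: O}) opbrk (lop (im_part (dual i))) (lop (f basis`_i)) x.
Proof.
move=> ifx; rewrite linear_sum /= sum_lfunE; apply: eq_bigr => i _.
by rewrite rho_cliff_brk !vsval_im_proj (im_part_imag (ifx _)).
Qed.

Lemma polar_im_part x w : imag w -> P (im_part x) w = P x w.
Proof.
by move=> /imagP iw; rewrite !polarE (polarC e1) iw mulr0 oppr0 addr0.
Qed.

(** The two terms of [opbrk_clifford] contract the dual bases, one through f and
    the other through its adjoint -f; each gives 2 L_(f w). *)
Lemma opbrk_casimir_lop f w x : derivation f -> skew_adj f -> imag w ->
  opbrk (rho (casimir f)) (lop w) x = 4 *: (f w ** x).
Proof.
move=> df sf iw; have ifx y := skew_imag y df sf.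
have ip y := imag_im_part y.
rewrite opbrkE !rho_casimir // linear_sum -sumrB /=.
under eq_bigr => i _ do rewrite -opbrkE opbrk_clifford // polar_im_part // sf.
rewrite -omul_suml -omulZl; congr (_ ** x).
have -> : 4 *: f w = 2 *: f w + 2 *: f w.
  by rewrite -scalerDl; congr (_ *: _); ring.
rewrite sumrB; congr (_ + _).
  rewrite -[in RHS](sum_polar_dual w) !linear_sum /=.
  by apply: eq_bigr => i _; rewrite linearZ /= scalerA.
rewrite -[in RHS](im_part_imag (ifx w)) -[in RHS](sum_polar_basis (f w)).
rewrite !linear_sum /=.
apply: eq_bigr => i _.
by rewrite mulrN scaleNr opprK -scalerA (linearZ_LR im_part).
Qed.

Lemma opbrk_im_part x y z :
  opbrk (lop (im_part x)) (lop y) z = opbrk (lop x) (lop y) z.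
Proof. by rewrite !opE /im_part; by_expanding. Qed.

(** Moving y = f(b_i) across the form rewrites P([d_i, y], z) as
    P(d_i, [y, z]), and the sum over i is then a trace. *)
Lemma polar_rho_casimir1 f z : derivation f -> skew_adj f ->
  P (rho (casimir f) e1) z = trace (f \o rop z)%VF - trace (f \o lop z)%VF.
Proof.
move=> df sf; have ifx y := skew_imag y df sf.
rewrite (trace_compC f (rop z)) (trace_compC f (lop z)) !trace_dual -sumrB.
rewrite rho_casimir // polar_suml; apply: eq_bigr => i _.
rewrite opbrk_im_part !opE !omul1r !polarE polar_mulr // polar_mull // opprK.
by rewrite addrC.
Qed.

(** The value e at 1 is orthogonal to all commutators by the trace formulas.
    Since P([e,u], v) = P(e, [u,v]), it is central. *)
Lemma rho_casimir1 f : derivation f -> skew_adj f -> rho (casimir f) e1 = 0.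
Proof.
move=> df sf; have ifx y := skew_imag y df sf.
set e := rho (casimir f) e1.
have ie : imag e.
  apply/imagP; rewrite polar_rho_casimir1 //; apply/eqP; rewrite subr_eq0.
  have -> // : rop e1 = lop e1.
  by apply/lfunP => x; rewrite !opE omul1l omul1r.
have e_comm u v : imag u -> imag v -> P e (ocomm u v) = 0.
  move=> iu iv; rewrite polar_rho_casimir1 //.
  by rewrite trace_rop_ocomm // trace_lop_ocomm // subrr.
apply: imag_central => // x; rewrite (im_decomp x).
move: (im_part x) (imag_im_part x) => u iu.
suff eu : ocomm e u = 0.
  by rewrite !omulE; congr (_ + _); apply: subr0_eq; exact: eu.
apply: nondegenerate_imag => // [|v iv].
  apply/imagP; rewrite /ocomm !polarE polar_mull // polar_mull // !omul1r.
  by rewrite polarC subrr.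
rewrite -(e_comm u v iu iv) /ocomm !polarE polar_mulr // polar_mull //.
by rewrite polarBr; ring.
Qed.

(** Evaluating [opbrk_casimir_lop] at 1 gives the action on imaginary w. *)
Lemma rho_casimirE f : derivation f -> skew_adj f -> rho (casimir f) = 4 *: f.
Proof.
move=> df sf; apply/lfunP => x; rewrite opscaleE (im_decomp x).
move: (im_part x) (imag_im_part x) => w iw.
rewrite !linearP /= rho_casimir1 // derivation1 // !scaler0 !add0r.
have := opbrk_casimir_lop e1 df sf iw.
by rewrite !opE rho_casimir1 // omul0r subr0 !omul1r.
Qed.

End Octonion.

(** * The moment map *)

Section MomentMap.
Variables (k : fieldType) (O : octonionAlgebra k).
Implicit Types (x y z : O) (a b : k) (f g h : 'End(O)) (u v w : ImO O).
Implicit Types c d : cliffordO O.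

Local Notation P := (polar (@oq k O)).
Local Notation e1 := (oone O).

Hypothesis two_neq0 : 2 != 0 :> k.
Hypothesis three_neq0 : 3 != 0 :> k.

(** Elements of g map all of O into Im(O), so the trace over Im(O) of a product
    is its trace over O; there multiplications have computable traces. *)
Lemma Bg_trace c d : in_g c -> in_g d ->
  Bg c d = - 3^-1 * trace (rho c \o rho d)%VF.
Proof.
move=> gc gd; rewrite /Bg; congr (_ * _).
pose p := linfun (vsproj (imO O)); pose i := linfun (@vsval _ _ (imO O)).
have ipK x : imag x -> i (p x) = x.
  by move=> ix; rewrite !lfunE /= vsprojK // mem_imO_imag.
have -> : (rho_im c \o rho_im d = p \o ((rho c \o rho d) \o i))%VF.
  by apply/lfunP => x; rewrite !comp_lfunE /= ipK //; exact: g_imag.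
rewrite (trace_compC p) -(comp_lfunA _ i p) (trace_compC (rho c \o rho d)%VF).
congr (trace _).
by apply/lfunP => x; rewrite !comp_lfunE ipK //; exact: g_imag.
Qed.

Lemma Bg_sym c d : in_g c -> in_g d -> Bg c d = Bg d c.
Proof. by move=> gc gd; rewrite !Bg_trace // trace_compC. Qed.

Lemma cliff_brk_linear u : linear (cliff_brk u).
Proof.
move=> a v w; rewrite /cliff_brk !linearP mulrDr mulrDl -scalerAr -scalerAl.
by rewrite opprD addrACA -scalerBr.
Qed.

Lemma casimir_linear : linear (@casimir k O).
Proof.
move=> a f g; rewrite /casimir scaler_sumr -big_split; apply: eq_bigr => i _.
by rewrite !opE linearP /= cliff_brk_linear.
Qed.

HB.instance Definition _ := GRing.isLinear.Build k
  'End(O) (cliffordO O) *:%R (@casimir k O) casimir_linear.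

(** The factor 1/16 is the 1/4 of the moment map times the 1/4 that undoes the
    factor of [rho_casimirE]. *)
Definition g2_moment u v : cliffordO O :=
  16^-1 *: casimir (inner_der (vsval u) (vsval v)).

Fact g2_moment_bilinear : bilinear_for *:%R *:%R g2_moment.
Proof.
split=> w a u v; rewrite /g2_moment [vsval (_ + _)]linearP.
  by rewrite inner_derDl casimir_linear scalerDr /= !scalerA (mulrC a).
by rewrite inner_derDr casimir_linear scalerDr /= !scalerA (mulrC a).
Qed.

HB.instance Definition _ := bilinear_isBilinear.Build k
  (ImO O) (ImO O) (cliffordO O) *:%R *:%R g2_moment g2_moment_bilinear.

Lemma rho_g2_moment u v :
  rho (g2_moment u v) = 4^-1 *: inner_der (vsval u) (vsval v).
Proof.
have iu := imag_vsval u; have iv := imag_vsval v.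
rewrite linearZ /= rho_casimirE // ?scalerA; last first.
- exact: skew_adj_inner_der.
- exact: inner_der_derivation.
have n4 : 4 != 0 :> k by rewrite (_ : 4 = 2 * 2) ?mulf_neq0 //; ring.
by congr (_ *: _); rewrite (_ : 16 = 4 * 4) ?invfM ?mulfVK //; ring.
Qed.

Lemma g2_moment_in_g u v : in_g (g2_moment u v).
Proof.
split; last first.
  rewrite rho_g2_moment opscaleE derivation1 ?scaler0 //.
  exact: inner_der_derivation.
exists (\dim {: O}), (fun=> 16^-1), (fun i => im_proj (dual i)),
  (fun i => im_proj (inner_der (vsval u) (vsval v) (vbasis {: O})`_i)).
by rewrite /g2_moment /casimir scaler_sumr.
Qed.

Lemma g2_moment_alt u : g2_moment u u = 0.
Proof.
by rewrite /g2_moment inner_der_alt linear0 scaler0.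
Qed.

(** The constants are (-1/3) * (1/4) * (-6) = 1/2, the ratio of B to the polar
    form. *)
Lemma moment_map_g2_moment : moment_map g2_moment.
Proof.
split=> [||c u v gc]; [exact: g2_moment_in_g|exact: g2_moment_alt|].
rewrite Bg_trace ?rho_g2_moment //; last exact: g2_moment_in_g.
rewrite -comp_lfunZr linearZ /= trace_inner_der ?imag_vsval //; last first.
- by move=> x; apply: g_imag.
- exact: g_derivation.
rewrite /oB !mulrA; congr (_ * _).
have n4 : 4 != 0 :> k by rewrite (_ : 4 = 2 * 2) ?mulf_neq0 //; ring.
by field; rewrite two_neq0 three_neq0 n4.
Qed.

(** Both sides paired with t equal Bg(mu(w,t), nu(u,v)) for the moment map mu
    built above, by symmetry of Bg, and this is B(rho(mu(w,t)) u, v). *)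
Lemma moment_map_unique (nu nu' : {bilinear ImO O -> ImO O -> cliffordO O})
    u v w :
  moment_map nu -> moment_map nu' ->
  rho (nu u v) (vsval w) = rho (nu' u v) (vsval w).
Proof.
move=> [nu_g _ nuB] [nu'_g _ nu'B]; have [_ _ muB] := moment_map_g2_moment.
have i0 c : in_g c -> P (rho c (vsval w)) e1 = 0.
  by move=> gc; apply/imagP; exact: g_imag.
apply: subr0_eq; apply: nondegenerate_imag => // [|x].
  by apply/imagP; rewrite !polarE !i0 ?subrr //.
rewrite -mem_imO_imag => /vsprojK <-; set t := vsproj _ x.
apply/eqP; rewrite !polarE subr_eq0; apply/eqP.
have n2 : 2^-1 != 0 :> k by rewrite invr_eq0.
apply: (mulfI n2); rewrite -!/(oB _ _) -!muB //.
rewrite !(Bg_sym _ (g2_moment_in_g w t)) // nuB ?nu'B //;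
  exact: g2_moment_in_g.
Qed.

End MomentMap.

Lemma natr_neq0_pchar (k : fieldType) p : prime p -> p \notin [pchar k] ->
  p%:R != 0 :> k.
Proof. by move=> pp; rewrite inE pp. Qed.

Theorem proposition4p1 (k : fieldType)
    (char_not2 : 2%N \notin [pchar k]) (char_not3 : 3%N \notin [pchar k])
    (O : octonionAlgebra k) :
  (exists mu : {bilinear ImO O -> ImO O -> cliffordO O}, moment_map mu) /\
  forall mu : {bilinear ImO O -> ImO O -> cliffordO O}, moment_map mu ->
  forall u v w : ImO O,
    rho (mu u v) (vsval w) =
      - (4%:R)^-1 *: (ocomm (vsval w) (ocomm (vsval u) (vsval v))
                      + 3%:R *: oassoc (vsval u) (vsval v) (vsval w)).
Proof.
have two_neq0 := natr_neq0_pchar (isT : prime 2) char_not2.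
have three_neq0 := natr_neq0_pchar (isT : prime 3) char_not3.
have g2_moment_ok := moment_map_g2_moment O two_neq0 three_neq0.
split=> [|nu nu_moment u v w]; first by exists (g2_moment (O := O)).
rewrite (moment_map_unique two_neq0 three_neq0 u v w nu_moment g2_moment_ok).
by rewrite rho_g2_moment // opscaleE inner_derE scaleNr scalerN.
Qed.
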